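(* Let $X,Y,Z$ be locally convex Hausdorff topological vector spaces, $K\subset Y$ a proper closed convex cone with $\operatorname{int}K\neq\emptyset$, $S\subset Z$ a nonempty convex cone, and $\Phi\colon X\times Z\to Y^\infty$ a proper $K$-convex mapping with $0_Z\in\pi(\operatorname{dom}\Phi)$, where $\pi(x,z)=z$. Consider the statements: (a) $\operatorname{epi}\Phi(\cdot,0_Z)^*=\bigcup_{T\in\mathcal L_\Phi}\operatorname{epi}\Phi^*(\cdot,T)$; (b) $\operatorname{epi}\Phi(\cdot,0_Z)^*=\bigcup_{T\in\mathcal L_\Phi^+}\operatorname{epi}\Phi^*(\cdot,T)$; (c) for all $(L,y)\in\mathcal L(X,Y)\times Y$, the following two assertions are equivalent: $(\alpha)$ $\Phi(x,0_Z)-L(x)+y\notin-\operatorname{int}K$ for all $x\in X$; $(\beta)$ there exists $T\in\mathcal L_\Phi$ such that $\Phi(x,z)-L(x)-T(z)+y\notin-\operatorname{int}K$ for all $(x,z)\in X\times Z$; (d) for all $(L,y)\in\mathcal L(X,Y)\times Y$, the following two assertions are equivalent: $(\alpha)$ $\Phi(x,0_Z)-L(x)+y\notin-\operatorname{int}K$ for all $x\in X$; $(\gamma)$ there exists $T\in\mathcal L_\Phi^+$ such that $\Phi(x,z)-L(x)-T(z)+y\notin-\operatorname{int}K$ for all $(x,z)\in X\times Z$. Then (a) is equivalent to (c), and (b) is equivalent to (d).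
   Context: Ordering: $K$ proper means $K\ne Y$. $y_1<_K y_2$ iff $y_1-y_2\in-\operatorname{int}K$. $Y^\infty=Y\cup\{+\infty_Y\}$, $Y^\bullet=Y\cup\{-\infty_Y,+\infty_Y\}$, where $-\infty_Y<_K y<_K+\infty_Y$ for $y\in Y$, $-\infty_Y<_K+\infty_Y$, $-(+\infty_Y)=-\infty_Y$, $y+(\pm\infty_Y)=\pm\infty_Y$ for $y\in Y$ (so $+\infty_Y\notin-\operatorname{int}K$). Weak supremum: for $M\subset Y^\bullet$, $\operatorname{WSup}M$ is the set of $\bar v\in Y^\bullet$ such that $\bar v\not<_K v$ for all $v\in M$ and for every $\tilde v\in Y^\bullet$ with $\tilde v<_K\bar v$ there is $v\in M$ with $\tilde v<_K v$. $\mathcal L(X,Y)$ is the space of continuous linear maps $X\to Y$. $\operatorname{dom}\Phi=\{(x,z):\Phi(x,z)\neq+\infty_Y\}$; $\Phi$ is proper if $\operatorname{dom}\Phi\neq\emptyset$ (the value $-\infty_Y$ is not taken); $\Phi$ is $K$-convex if $\{(x,z,y)\in X\times Z\times Y:y\in\Phi(x,z)+K\}$ is convex. Conjugates: $\Phi^*(L,T)=\operatorname{WSup}\{L(x)+T(z)-\Phi(x,z):(x,z)\in X\times Z\}$ for $(L,T)\in\mathcal L(X,Y)\times\mathcal L(Z,Y)$; $\Phi(\cdot,0_Z)^*(L)=\operatorname{WSup}\{L(x)-\Phi(x,0_Z):x\in X\}$. $\operatorname{epi}\Phi(\cdot,0_Z)^*=\{(L,y)\in\mathcal L(X,Y)\times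 Y:y\in\Phi(\cdot,0_Z)^*(L)+K\}$ and $\operatorname{epi}\Phi^*(\cdot,T)=\{(L,y)\in\mathcal L(X,Y)\times Y:y\in\Phi^*(L,T)+K\}$ (where $\{\pm\infty_Y\}+K=\{\pm\infty_Y\}$). $\mathcal L_\Phi=\{T\in\mathcal L(Z,Y):\exists L\in\mathcal L(X,Y),\ \Phi^*(L,T)\neq\{+\infty_Y\}\}$, $\mathcal L_+(S,K)=\{T\in\mathcal L(Z,Y):T(S)\subset K\}$, $\mathcal L_\Phi^+=\mathcal L_\Phi\cap\mathcal L_+(S,K)$. *)

(* Defs.v *)
From HB Require Import structures.
From mathcomp Require Import all_boot all_order all_algebra.
From mathcomp Require Import all_classical all_reals all_analysis.

Set Implicit Arguments.
Unset Strict Implicit.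
Unset Printing Implicit Defensive.

Import Order.TTheory GRing.Theory Num.Theory.

Local Open Scope classical_set_scope.
Local Open Scope ring_scope.

(* The cone is not required to contain 0 (scalars are taken strictly positive);
   a nonempty closed cone in this sense contains 0 automatically. *)
Definition is_cone (R : numDomainType) (E : lmodType R) (A : set E) : Prop :=
  forall (t : R) (a : E), 0 < t -> A a -> A (t *: a).

Definition convex_cone (R : numDomainType) (E : lmodType R) (A : set E) : Prop :=
  convex_set (A : set (convex_lmodType E)) /\ is_cone A.

Record clin (R : numDomainType) (X Y : tvsType R) := Clin {
  clin_fun :> {linear X -> Y};
  clin_continuous : continuous clin_fun
}.

(* The type Y^bullet = Y \cup {-oo_Y, +oo_Y}. *)
Inductive ext (Y : Type) : Type := NInfty | Fin of Y | PInfty.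
Arguments NInfty {Y}.
Arguments PInfty {Y}.

Definition eopp (Y : zmodType) (v : ext Y) : ext Y :=
  match v with NInfty => PInfty | Fin a => Fin (- a) | PInfty => NInfty end.

(* Only y + v with y finite is meaningful; (-oo) + (+oo) is never formed. *)
Definition eadd (Y : zmodType) (y : Y) (v : ext Y) : ext Y :=
  match v with NInfty => NInfty | Fin a => Fin (y + a) | PInfty => PInfty end.

Definition edom (E Y : Type) (F : E -> ext Y) : set E := [set e | F e <> PInfty].

Definition eproper (E Y : Type) (F : E -> ext Y) : Prop := edom F !=set0.

Section Ordering.
Variables (R : realType) (Y : tvsType R) (K : set Y).

Definition opp_int : set Y := [set - k | k in interior K].

(* Membership of an extended vector in - int K; infinite v are never members. *)
Definition in_opp_int (v : ext Y) : Prop := (@Fin Y @` opp_int) v.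

(* u <_K v *)
Definition ltK (u v : ext Y) : Prop :=
  match u, v with
  | Fin a, Fin b => opp_int (a - b)
  | NInfty, Fin _ | NInfty, PInfty | Fin _, PInfty => True
  | _, _ => False
  end.

Definition WSup (M : set (ext Y)) : set (ext Y) :=
  [set w | (forall v, M v -> ~ ltK w v) /\
           (forall u, ltK u w -> exists2 v, M v & ltK u v)].

Definition addK (M : set (ext Y)) : set (ext Y) :=
  [set v | exists2 m, M m & exists2 k, K k & v = eadd k m].

End Ordering.

Section Conjugates.
Variables (R : realType) (X Y Z : tvsType R) (K : set Y).

Definition K_convex (F : X * Z -> ext Y) : Prop :=
  convex_set ([set p | addK K [set F p.1] (Fin p.2)]
              : set (convex_lmodType (X * Z * Y)%type)).

Definition econj (F : X -> ext Y) (L : clin X Y) : set (ext Y) :=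
  WSup K [set eadd (L x) (eopp (F x)) | x in setT].

Definition econj2 (F : X * Z -> ext Y) (L : clin X Y) (T : clin Z Y)
  : set (ext Y) :=
  WSup K [set eadd (L p.1 + T p.2) (eopp (F p)) | p in setT].

Definition epiK (G : clin X Y -> set (ext Y)) : set (clin X Y * Y) :=
  [set Ly | addK K (G Ly.1) (Fin Ly.2)].

Definition L_conj (F : X * Z -> ext Y) : set (clin Z Y) :=
  [set T | exists L : clin X Y, econj2 F L T <> [set PInfty]].

Definition L_pos (S : set Z) : set (clin Z Y) :=
  [set T | [set T z | z in S] `<=` K].

Definition L_conj_pos (S : set Z) (F : X * Z -> ext Y) : set (clin Z Y) :=
  L_conj F `&` L_pos S.

End Conjugates.

(* Main.v *)
(* For M containing a finite value, y lies in WSup M + K iff y <_K v for no v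
   in M: if no such v exists, move from y along a direction -c with c in int K
   as far as this property persists; the end point is in WSup M. Applied to
   M = {L x - F x}, this turns membership in the epigraph of a conjugate into
   the condition F x - L x + y \notin - int K for all x, and both equivalences
   follow pointwise in (L, y). *)
Require Import Defs.
From HB Require Import structures.
From mathcomp Require Import all_boot all_order all_algebra.
From mathcomp Require Import all_classical all_reals all_analysis.
From mathcomp Require Import ring.

Set Implicit Arguments.
Unset Strict Implicit.
Unset Printing Implicit Defensive.

Import Order.TTheory GRing.Theory Num.Theory.

Local Open Scope classical_set_scope.
Local Open Scope ring_scope.

Section Cone.
Variables (R : realType) (Y : tvsType R) (K : set Y).

(** Continuity of scaling at [(0, w)], after translating [c] to the origin. *)
Lemma nbhs_line (A : set Y) (c w : Y) :
  nbhs c A -> exists2 e : R, 0 < e & A (c + e *: w).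
Proof.
move=> cA.
have := nbhsB (- c) cA; rewrite addNr -(scale0r w) => cA0.
have [[B1 B2] /= [B10 B2w] BA] := scale_continuous ((0 : R^o), w) _ cA0.
have /nbhs_ballP[e /= e0 eB] := B10.
exists (e / 2); first by rewrite divr_gt0.
have : (B1 `*` B2) (e / 2, w).
  split; last exact: nbhs_singleton.
  apply: eB; rewrite -ball_normE /ball_ /= sub0r normrN gtr0_norm ?divr_gt0//.
  by rewrite ltr_pdivrMr// ltr_pMr// ltr1n.
by move=> /BA[b Ab /= <-]; rewrite addNKr.
Qed.

Hypothesis K_cone : convex_cone K.

(** The sum is twice the midpoint of [a] and [b]. *)
Lemma convex_coneD (a b : Y) : K a -> K b -> K (a + b).
Proof.
case: K_cone => convK coneK Ka Kb.
have i0 : 0 <= 2^-1 :> R by rewrite invr_ge0.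
have i1 : 2^-1 <= 1 :> R by rewrite invf_le1// ler1n.
have Kab : K (2^-1 *: a + (1 - 2^-1) *: b).
  exact: set_mem (convK a b (Itv01 i0 i1) (mem_set Ka) (mem_set Kb)).
have := coneK _ _ (ltr0Sn R 1) Kab.
rewrite scalerDr !scalerA mulfV ?pnatr_eq0// scale1r.
by have -> : 2 * (1 - 2^-1) = 1 :> R by [field]; rewrite scale1r.
Qed.

Lemma interior_coneZ (t : R) (a : Y) : 0 < t -> K° a -> K° (t *: a).
Proof.
move=> t0 Ka; case: K_cone => _ coneK.
apply: filterS (nbhsZ (lt0r_neq0 t0) Ka) => _ [w Kw <-].
exact: coneK.
Qed.

Lemma interior_coneD (a k : Y) : K° a -> K k -> K° (a + k).
Proof.
move=> Ka Kk.
rewrite addrC; apply: filterS (nbhsB k Ka) => _ [w Kw <-].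
exact: convex_coneD.
Qed.

(** Otherwise the complement, a neighbourhood of 0, would contain a small positive multiple of a
    point of [K]. *)
Lemma closed_cone0 : closed K -> K !=set0 -> K 0.
Proof.
move=> clK [c Kc]; apply: contrapT => nK0.
have nb0 : nbhs (0 : Y) (~` K).
  by apply: open_nbhs_nbhs; split=> //; apply: closed_openC.
have [e e0] := nbhs_line c nb0.
by rewrite add0r; apply; case: K_cone => _; apply.
Qed.

Lemma opp_intE (a : Y) : opp_int K a <-> K° (- a).
Proof.
split=> [[k Kk <-]|Ka]; first by rewrite opprK.
by exists (- a); rewrite ?opprK.
Qed.

Lemma ltK_FinE (a b : Y) : ltK K (Fin a) (Fin b) <-> K° (b - a).
Proof. by rewrite /= opp_intE opprB. Qed.

(** The vector [k] is absorbed because [K° + K] lies in [K°]. *)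
Lemma ltK_FinDl (a k : Y) (v : ext Y) :
  K k -> ltK K (Fin (a + k)) v -> ltK K (Fin a) v.
Proof.
case: v => // b Kk /ltK_FinE/interior_coneD/(_ Kk).
by rewrite opprD addrA subrK => /ltK_FinE.
Qed.

Lemma ltK_Fin_trans (d a : Y) (v : ext Y) :
  ltK K (Fin d) (Fin a) -> ltK K (Fin a) v -> ltK K (Fin d) v.
Proof.
move=> /ltK_FinE/interior_subset Kda av.
by apply: (ltK_FinDl Kda); rewrite subrKC.
Qed.

(** The strict order is an open condition, so it leaves room in any direction. *)
Lemma ltK_line (a w : Y) (v : ext Y) :
  ltK K (Fin a) v -> exists2 e : R, 0 < e & ltK K (Fin (a + e *: w)) v.
Proof.
case: v => // [b /ltK_FinE /nbhs_interior|_]; last by exists 1.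
move=> /(nbhs_line (- w))[e e0 Ke]; exists e => //; apply/ltK_FinE.
by rewrite opprD addrA -scalerN.
Qed.

Lemma addK_WSup_ltK (M : set (ext Y)) (y : Y) :
  addK K (WSup K M) (Fin y) -> forall v, M v -> ~ ltK K (Fin y) v.
Proof.
move=> [[|a|] // [aM _] [k Kk //= [->]]] v Mv.
by rewrite addrC => /(ltK_FinDl Kk); apply: aM.
Qed.

Lemma ltK_addK_WSup (M : set (ext Y)) (a0 y : Y) :
  closed K -> K° !=set0 -> M (Fin a0) ->
  (forall v, M v -> ~ ltK K (Fin y) v) -> addK K (WSup K M) (Fin y).
Proof.
move=> clK [c Kc] Ma0 yM.
have coneK := K_cone.2; have KcW := interior_subset Kc.
pose A := [set t : R | forall v, M v -> ~ ltK K (Fin (y - t *: c)) v].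
have A0 : A 0 by move=> v /yM; rewrite scale0r subr0.
have supA : has_sup A.
  split; first by exists 0.
  (* To bound [A]: [c + e *: (a0 - y)] is interior for some [e > 0]; dividing by [e] gives
     [y - e^-1 *: c] strictly below [a0], and larger steps only go further down. *)
  have [e e0] := nbhs_line (a0 - y) (nbhs_interior Kc).
  have ei0 : 0 < e^-1 by rewrite invr_gt0.
  move=> /(interior_coneZ ei0).
  rewrite scalerDr scalerA mulVf ?gt_eqF// scale1r => Ke.
  exists e^-1 => s As; rewrite leNgt; apply/negP => es.
  apply: As Ma0 _; apply/ltK_FinE.
  have -> : a0 - (y - s *: c) = e^-1 *: c + (a0 - y) + (s - e^-1) *: c.
    by rewrite addrAC -scalerDl addrC subrKC opprB addrA addrAC.
  by apply: interior_coneD => //; apply: coneK => //; rewrite subr_gt0.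
set t := sup A.
have t0 : 0 <= t by apply: sup_upper_bound.
have Kt : K (t *: c).
  (* The case [t = 0] is separate since [K] is only assumed stable under positive scalars. *)
  have [->|tn0] := eqVneq t 0.
    by rewrite scale0r; apply: closed_cone0 => //; exists c.
  by apply: coneK; rewrite // lt_def tn0.
exists (Fin (y - t *: c)); last by exists (t *: c); rewrite //= subrKC.
split=> [v Mv /(ltK_line c)[e e0]|[|d|]//].
(* The end point has no [v] above it: some [s] in [A] exceeds [t - e], so [y - s *: c], being lower
   than [y - (t - e) *: c], would lie below [v] too. *)
- have [s As ts] := sup_adherent e0 supA.
  have -> : y - t *: c + e *: c = y - s *: c + (s - (t - e)) *: c.
    by rewrite scalerBl addrA subrK scalerBl opprB addrCA addrC addrAC.
  have Ks : K ((s - (t - e)) *: c) by apply: coneK; rewrite ?subr_gt0.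
  by move=> /(ltK_FinDl Ks); apply: As.
- by exists (Fin a0).
(* The room [e] puts [d] below [y - (t + e) *: c], and [t + e], exceeding the supremum, is not in
   [A]: some [v] in [M] is above that point. *)
- move=> /(ltK_line c)[e e0 dt].
  have /existsNP[v /not_implyP[Mv /contrapT vt]] : ~ A (t + e).
    by move=> /(sup_upper_bound supA); rewrite leNgt ltrDl e0.
  exists v => //; apply: ltK_Fin_trans vt.
  move: dt => /ltK_FinE Kd; apply/ltK_FinE.
  suff -> : y - (t + e) *: c - d = y - t *: c - (d + e *: c) by [].
  by rewrite scalerDl !opprD !addrA [RHS]addrAC.
Qed.

End Cone.

(** Where [F i] is finite, [y] below [l i - F i] means [y - l i + F i] is in [- int K]; where it is
    [PInfty], both conditions fail. Properness supplies the finite value that the weak supremum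
    needs. *)
Lemma addK_WSup_conjP (R : realType) (Y : tvsType R) (K : set Y)
    (I : Type) (l : I -> Y) (F : I -> ext Y) (y : Y) :
  convex_cone K -> closed K -> K° !=set0 ->
  (forall i, F i <> NInfty) -> eproper F ->
  addK K (WSup K [set eadd (l i) (eopp (F i)) | i in setT]) (Fin y) <->
  forall i, ~ in_opp_int K (eadd y (eadd (- l i) (F i))).
Proof.
move=> K_cone K_closed K_int FN [i0 Fi0].
have ltKE i : ltK K (Fin y) (eadd (l i) (eopp (F i))) <->
    in_opp_int K (eadd y (eadd (- l i) (F i))).
  case: (F i) (FN i) => //= [b _|_]; last by split=> // -[].
  rewrite opprB [b - _]addrC; split=> [Kb|[_ Kb [<-]]//].
  by exists (y + (- l i + b)).
split=> [/(addK_WSup_ltK K_cone) yM i /ltKE|yM].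
  by apply: yM; exists i.
have [b Fb] : exists b, F i0 = Fin b.
  move: (FN i0) (Fi0 : F i0 <> PInfty).
  by case: (F i0) => // b _ _; exists b.
apply: (@ltK_addK_WSup _ _ _ K_cone _ (l i0 - b)) => //.
  by exists i0; rewrite ?Fb.
by move=> _ [i _ <-] /ltKE; apply: yM.
Qed.

(** Serves both equivalences, with [D] either [L_conj] or [L_conj_pos]. *)
Lemma bigcup_epiP (A B I : Type) (E : set (A * B)) (D : set I)
    (G : I -> set (A * B)) (P : A -> B -> Prop) (Q : I -> A -> B -> Prop) :
  (forall a b, E (a, b) <-> P a b) ->
  (forall i a b, G i (a, b) <-> Q i a b) ->
  E = \bigcup_(i in D) G i <->
  forall a b, P a b <-> exists i, D i /\ Q i a b.
Proof.
move=> EP GQ; split=> [EG a b|PQ].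
  rewrite -EP EG; split=> [[i Di /GQ]|[i [Di /GQ]]]; first by exists i.
  by exists i.
apply/seteqP; split=> -[a b].
  by move=> /EP/PQ[i [Di /GQ]]; exists i.
by move=> [i Di /GQ Qi]; apply/EP/PQ; exists i.
Qed.

Theorem theorem3p4 (R : realType) (X Y Z : tvsType R)
  (hausX : hausdorff_space X) (hausY : hausdorff_space Y)
  (hausZ : hausdorff_space Z)
  (K : set Y) (K_proper : K <> setT) (K_closed : closed K)
  (K_cone : convex_cone K) (K_int : interior K !=set0)
  (S : set Z) (S_nonempty : S !=set0) (S_cone : convex_cone S)
  (Phi : X * Z -> ext Y) (Phi_codom : forall p, Phi p <> NInfty)
  (Phi_proper : eproper Phi) (Phi_convex : K_convex K Phi)
  (Phi_dom0 : (snd @` edom Phi) 0) :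
  (epiK K (econj K (fun x => Phi (x, 0)))
     = \bigcup_(T in L_conj K Phi) epiK K (fun L => econj2 K Phi L T)
   <->
   (forall (L : clin X Y) (y : Y),
      (forall x, ~ in_opp_int K (eadd y (eadd (- L x) (Phi (x, 0)))))
      <->
      (exists T : clin Z Y, L_conj K Phi T /\
        forall x z, ~ in_opp_int K
          (eadd y (eadd (- T z) (eadd (- L x) (Phi (x, z))))))))
  /\
  (epiK K (econj K (fun x => Phi (x, 0)))
     = \bigcup_(T in L_conj_pos K S Phi) epiK K (fun L => econj2 K Phi L T)
   <->
   (forall (L : clin X Y) (y : Y),
      (forall x, ~ in_opp_int K (eadd y (eadd (- L x) (Phi (x, 0)))))
      <->
      (exists T : clin Z Y, L_conj_pos K S Phi T /\
        forall x z, ~ in_opp_int K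
          (eadd y (eadd (- T z) (eadd (- L x) (Phi (x, z)))))))).
Proof.
(* The domain point over 0 makes [Phi (x, 0)] proper in [x]. *)
have [[x0 z0] /= dom0 z0E] := Phi_dom0; rewrite z0E in dom0.
have epi0P (L : clin X Y) (y : Y) :
    epiK K (econj K (fun x => Phi (x, 0))) (L, y) <->
    forall x, ~ in_opp_int K (eadd y (eadd (- L x) (Phi (x, 0)))).
  by apply: addK_WSup_conjP => //; exists x0.
have epiTP (T : clin Z Y) (L : clin X Y) (y : Y) :
    epiK K (fun L => econj2 K Phi L T) (L, y) <->
    forall x z, ~ in_opp_int K
      (eadd y (eadd (- T z) (eadd (- L x) (Phi (x, z))))).
  (* Merging the two shifts presents [econj2] as a conjugate over pairs, with
     [l p = L p.1 + T p.2]. *)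
  have eaddE x z : eadd (- T z) (eadd (- L x) (Phi (x, z))) =
      eadd (- (L x + T z)) (Phi (x, z)).
    by case: (Phi _) => //= b; rewrite opprD addrCA addrA.
  rewrite /epiK /econj2 /= addK_WSup_conjP//.
  split=> [H x z|H [x z]]; first by rewrite eaddE; exact: (H (x, z)).
  by rewrite -eaddE; exact: H.
by split; apply: bigcup_epiP.
Qed.
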